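(* Let $f=2-x^{-1}-y^{-1}\in\mathbb{Z}[\mathbb{H}]$, so that $f^*=2-x-y$, and let ${f^*}^\sharp\in\ell^\infty(\mathbb{H},\mathbb{R})$ be the formal inverse of $f^*$ given by $${f^*}^\sharp=\sum_{n=0}^\infty\frac1{2^{n+1}}(x+y)^n=\sum_{n=0}^{\infty}\frac{1}{2^{n+1}}\sum_{k=0}^n x^ky^{n-k}\genfrac{[}{]}{0pt}{}{n}{k}_{q},\qquad q=z^{-1}.$$ Then $(1-z^{-1})^2\cdot{f^*}^\sharp\in\ell^1(\mathbb{H},\mathbb{R})$. Hence the point $\bar x=(\bar x_\gamma)_{\gamma\in\mathbb{H}}\in\mathbb{T}^{\mathbb{H}}$ defined by $$\bar x_\gamma=\bigl({f^*}^\sharp\cdot(1-z^{-1})^2\bigr)_\gamma \pmod 1,\qquad \gamma\in\mathbb{H},$$ is a summable homoclinic point in $X_f$.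
   Context: $\mathbb{H}$ is the discrete Heisenberg group of upper triangular unipotent integer $3\times3$ matrices, with the standard generators $x,y$ (ones in position $(1,2)$, resp. $(2,3)$) and central element $z=xyx^{-1}y^{-1}$, so that $xz=zx$, $yz=zy$ and $x^ky^l=y^lx^kz^{kl}$ for $k,l\in\mathbb{Z}$. Elements of $\mathbb{R}^{\mathbb{H}}$ are written as formal sums $\sum_\gamma v_\gamma\gamma$, and products are convolutions. For $h=\sum_\gamma h_\gamma\gamma$ with real coefficients, $h^*=\sum_\gamma h_\gamma\gamma^{-1}$. The $q$-binomial coefficient is $\genfrac{[}{]}{0pt}{}{n}{k}_{q}=\prod_{i=0}^{k-1}\frac{1-q^{n-i}}{1-q^{i+1}}$, a polynomial in $q$ (here evaluated at $q=z^{-1}$). ''Formal inverse'' means ${f^*}^\sharp\cdot f^*=f^*\cdot{f^*}^\sharp=1$. $\mathbb{T}=\mathbb{R}/\mathbb{Z}$. The shift actions on $\mathbb{T}^{\mathbb{H}}$ are $(\lambda^\gamma x)_{\gamma'}=x_{\gamma^{-1}\gamma'}$ and $(\rho^\gamma x)_{\gamma'}=x_{\gamma'\gamma}$; for $f\in\mathbb{Z}[\mathbb{H}]$, $\rho^f=\sum_\gamma f_\gamma\rho^\gamma$. The principal algebraic action $(X_f,\alpha_f)$ is given by $X_f=\ker\rho^f\subset\mathbb{T}^{\mathbb{H}}$ and $\alpha_f=$ the restriction of $\lambda$ to $X_f$. A point $x\in X_f$ is homoclinic if $\alpha_f^\gamma x\to0$ as $\gamma\to\infty$, and a homoclinic point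 is summable if $\sum_\gamma |\!|x_\gamma|\!|<\infty$, where $|\!|t|\!|$ is the distance of $t\in\mathbb{T}$ from $0$. *)

(* Defs.v *)
From HB Require Import structures.
From mathcomp Require Import all_boot all_order all_algebra.
From mathcomp Require Import generic_quotient ring_quotient.
From mathcomp Require Import all_classical all_reals all_analysis.
From mathcomp Require Import ring.

Set Implicit Arguments.
Unset Strict Implicit.
Unset Printing Implicit Defensive.

Import Order.TTheory GRing.Theory Num.Theory.
Import numFieldNormedType.Exports.

Local Open Scope classical_set_scope.
Local Open Scope ring_scope.

Section Heisenberg.

Definition unitriangular (A : 'M[int]_3) : bool :=
  [forall i : 'I_3, forall j : 'I_3, (j <= i)%N ==> (A i j == (i == j)%:R)].

Record heis := Heis { heis_mx :> 'M[int]_3; heis_mxP : unitriangular heis_mx }.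

HB.instance Definition _ := [isSub for heis_mx].
HB.instance Definition _ := [Choice of heis by <:].

Definition heis_mat (a b c : int) : 'M[int]_3 :=
  \matrix_(i < 3, j < 3)
    nth 0 (nth [::] [:: [:: 1; a; c]; [:: 0; 1; b]; [:: 0; 0; 1]] i) j.

Lemma heis_matP a b c : unitriangular (heis_mat a b c).
Proof.
apply/forallP => i; apply/forallP => j; rewrite mxE.
by case: i => [[|[|[|//]]] ?]; case: j => [[|[|[|//]]] ?].
Qed.

Definition heis_of a b c := Heis (heis_matP a b c).

Let i0 : 'I_3 := @Ordinal 3 0 isT.
Let i1 : 'I_3 := @Ordinal 3 1 isT.
Let i2 : 'I_3 := @Ordinal 3 2 isT.

Lemma heis_mat_eq (A : 'M[int]_3) : unitriangular A ->
  A = heis_mat (A i0 i1) (A i1 i2) (A i0 i2).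
Proof.
move=> /forallP h; apply/matrixP => i j; rewrite mxE.
have {}h (k l : 'I_3) : (l <= k)%N -> A k l = (k == l)%:R.
  by move=> lk; have /forallP/(_ l)/implyP/(_ lk)/eqP := h k.
case: i => [[|[|[|//]]] ?]; case: j => [[|[|[|//]]] ?] /=;
  by [rewrite h | congr (A _ _); apply: val_inj].
Qed.

Lemma heisE (A : heis) : A = heis_of (A i0 i1) (A i1 i2) (A i0 i2).
Proof. by apply: val_inj => /=; apply/heis_mat_eq/heis_mxP. Qed.

Lemma heis_ofK a b c : [/\ heis_of a b c i0 i1 = a, heis_of a b c i1 i2 = b
  & heis_of a b c i0 i2 = c].
Proof. by split; rewrite mxE. Qed.

Lemma heis_matM a b c a' b' c' : heis_mat a b c *m heis_mat a' b' c' =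
  heis_mat (a + a') (b + b') (c + c' + a * b').
Proof.
apply/matrixP => i j; rewrite !mxE 3!big_ord_recl big_ord0 !mxE.
case: i => [[|[|[|//]]] ?]; case: j => [[|[|[|//]]] ?] /=; ring.
Qed.

Lemma heis_mat1 : heis_mat 0 0 0 = 1%:M.
Proof.
apply/matrixP => i j; rewrite !mxE.
by case: i => [[|[|[|//]]] ?]; case: j => [[|[|[|//]]] ?].
Qed.

Lemma unitriangularM (A B : heis) : unitriangular (A *m B).
Proof. by rewrite (heisE A) (heisE B) heis_matM heis_matP. Qed.

Lemma unitriangular1 : unitriangular 1%:M.
Proof. by rewrite -heis_mat1 heis_matP. Qed.

Lemma heis_matV a b c :
  invmx (heis_mat a b c) = heis_mat (- a) (- b) (a * b - c).
Proof.
have VM : heis_mat (- a) (- b) (a * b - c) *m heis_mat a b c = 1%:M.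
  by rewrite heis_matM -heis_mat1; congr heis_mat; ring.
have [_ /mulmx1_unit[_ u]] := (I, VM).
by rewrite -[LHS]mul1mx -VM -mulmxA mulmxV // mulmx1.
Qed.

Lemma unitriangularV (A : heis) : unitriangular (invmx A).
Proof. by rewrite (heisE A) heis_matV heis_matP. Qed.

Definition heis_mul (A B : heis) : heis := Heis (unitriangularM A B).
Definition heis_one : heis := Heis unitriangular1.
Definition heis_inv (A : heis) : heis := Heis (unitriangularV A).

Lemma heis_unit (A : heis) : heis_mx A \in unitmx.
Proof.
rewrite (heisE A) unitmxE.
have VM a b c : heis_mat a b c *m heis_mat (- a) (- b) (a * b - c) = 1%:M.
  by rewrite heis_matM -heis_mat1; congr heis_mat; ring.
by rewrite -unitmxE; have [] := mulmx1_unit (VM (A i0 i1) (A i1 i2) (A i0 i2)).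
Qed.

Fact heis_mulA : associative heis_mul.
Proof. by move=> A B C; apply: val_inj; rewrite /= mulmxA. Qed.
Fact heis_mul1g : left_id heis_one heis_mul.
Proof. by move=> A; apply: val_inj; rewrite /= mul1mx. Qed.
Fact heis_mulg1 : right_id heis_one heis_mul.
Proof. by move=> A; apply: val_inj; rewrite /= mulmx1. Qed.
Fact heis_mulVg : left_inverse heis_one heis_inv heis_mul.
Proof. by move=> A; apply: val_inj; rewrite /= mulVmx ?heis_unit. Qed.
Fact heis_mulgV : right_inverse heis_one heis_inv heis_mul.
Proof. by move=> A; apply: val_inj; rewrite /= mulmxV ?heis_unit. Qed.

HB.instance Definition _ := isGroup.Build heis
  heis_mulA heis_mul1g heis_mulg1 heis_mulVg heis_mulgV.

Lemma heis_ofM a b c a' b' c' : (heis_of a b c * heis_of a' b' c')%g =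
  heis_of (a + a') (b + b') (c + c' + a * b').
Proof. by apply: val_inj; rewrite /= heis_matM. Qed.

Lemma heis_of1 : heis_of 0 0 0 = 1%g.
Proof. by apply: val_inj; rewrite /= heis_mat1. Qed.

Lemma heis_ofV a b c : ((heis_of a b c)^-1)%g = heis_of (- a) (- b) (a * b - c).
Proof. by apply: val_inj; rewrite /= heis_matV. Qed.

Definition hx : heis := heis_of 1 0 0.
Definition hy : heis := heis_of 0 1 0.
Definition hz : heis := (hx * hy * hx^-1 * hy^-1)%g.

Lemma hzE : hz = heis_of 0 0 1.
Proof. by rewrite /hz !heis_ofV !heis_ofM; congr heis_of; ring. Qed.

End Heisenberg.

Section GroupRing.
Variables (G : groupType) (K : nzRingType).
Implicit Types (v w : G -> K) (g : G).

(* The formal sum [g]; note that [1 : G -> K] would be the constant function. *)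
Definition delta g : G -> K := fun h => (h == g)%:R.

(* Meaningful when v or w has finite support, which is the case of every product
   below: [\sum_(_ \in _)] is the sum over the support of the summand when that
   support is finite, and 0 otherwise. *)
Definition gconv v w : G -> K :=
  fun g => \sum_(d \in [set: G]) v d * w (d^-1 * g)%g.

Definition cpow v (n : nat) : G -> K := iter n (gconv v) (delta 1%g).

Definition star v : G -> K := fun g => v g^-1%g.

Definition formal_inverse v w : Prop :=
  gconv v w = delta 1%g /\ gconv w v = delta 1%g.

Definition poly_at (p : {poly int}) v : G -> K :=
  fun g => \sum_(j < size p) (p`_j)%:~R * cpow v j g.

End GroupRing.

Arguments delta {G K} g.

(* Quotient in {poly int}; it is exact by qbinomK (the denominator has leading
   coefficient +1 or -1). For i <= k - 1 and k <= n, n - i is not truncated. *)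
Definition qbinom (n k : nat) : {poly int} :=
  (\prod_(i < k) (1 - 'X^(n - i))) %/ (\prod_(i < k) (1 - 'X^(i.+1))).

Lemma qbinomK n k :
  qbinom n k * \prod_(i < k) (1 - 'X^(i.+1)) = \prod_(i < k) (1 - 'X^(n - i)).
Proof.
pose D k : {poly int} := \prod_(i < k) (1 - 'X^(i.+1)).
pose N n k : {poly int} := \prod_(i < k) (1 - 'X^(n - i)).
have D0 m : lead_coef (D m) \is a GRing.unit.
  rewrite /D lead_coef_prod; apply: rpred_prod => i _.
  rewrite addrC lead_coefDl ?lead_coefN ?lead_coefXn ?unitrN ?unitr1 //.
  by rewrite size_polyN size_polyXn size_poly1.
have NS m l : N m.+1 l.+1 = (1 - 'X^(m.+1)) * N m l.
  by rewrite /N big_ord_recl subn0; congr (_ * _); apply: eq_bigr.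
have NSr m l : N m l.+1 = N m l * (1 - 'X^(m - l)) by rewrite /N big_ord_recr.
have N0 m l : (m < l)%N -> N m l = 0.
  move=> ml; apply/eqP/prodf_eq0; exists (Ordinal ml) => //=.
  by rewrite subnn expr0 subrr.
have [P PE] : exists P : {poly int}, P * D k = N n k.
  elim: n k => [|n IHn] [|k]; try by exists 1; rewrite mul1r /D /N !big_ord0.
    by exists 0; rewrite N0 // mul0r.
  have [[P1 P1E] [P2 P2E]] := (IHn k, IHn k.+1).
  exists (P1 + 'X^(k.+1) * P2); rewrite mulrDl -mulrA P2E NS NSr.
  have -> : D k.+1 = D k * (1 - 'X^(k.+1)) by rewrite /D big_ord_recr.
  rewrite mulrA P1E; have [kn|nk] := leqP k n; last by rewrite N0 //; ring.
  have -> : 'X^(n.+1) = 'X^(k.+1) * 'X^(n - k) :> {poly int}.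
    by rewrite -exprD addSn subnKC.
  ring.
by rewrite /qbinom -/(D k) -/(N n k) -PE Pdiv.IdomainUnit.mulpK.
Qed.

Section Torus.
Variable R : realType.

Definition Zint : {pred R} := fun r => r \is a Num.int.

Fact Zint_zmod : zmod_closed Zint.
Proof. by split=> [|r s]; [exact: rpred0 | exact: rpredB]. Qed.

HB.instance Definition _ := GRing.isZmodClosed.Build R Zint Zint_zmod.

Definition circle : Type := Quotient.quot Zint.
HB.instance Definition _ := GRing.Zmodule.on circle.

Definition mod1 (r : R) : circle := \pi_(Quotient.quot Zint)%qT r.

(* The quotient topology; [quotient_topology] itself carries no group law. *)
Definition circle_open (U : set circle) : Prop := open (mod1 @^-1` U).

Fact circle_openT : circle_open setT.
Proof. exact: openT. Qed.
Fact circle_openI : setI_closed circle_open.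
Proof. by move=> A B; exact: openI. Qed.
Fact circle_open_bigU (I : Type) (F : I -> set circle) :
  (forall i, circle_open (F i)) -> circle_open (\bigcup_i F i).
Proof. by move=> Fo; apply: bigcup_open => i _; exact: Fo. Qed.

HB.instance Definition _ := isOpenTopological.Build circle
  circle_openT circle_openI circle_open_bigU.

Lemma circle_openE (U : set circle) : open U = open (mod1 @^-1` U).
Proof. by []. Qed.

Lemma mod1E (r s : R) : mod1 r = mod1 s <-> r - s \is a Num.int.
Proof.
rewrite -[_ \is a _]/(r - s \in (Zint : zmodClosed R)) Quotient.idealrBE.
by split=> /eqP.
Qed.

Lemma mod1_additive : zmod_morphism mod1.
Proof. by move=> r s; rewrite /mod1 !piE. Qed.

Definition circle_norm (t : circle) : R :=
  inf [set `|r| | r in [set r : R | mod1 r = t]].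

End Torus.

Section PrincipalAction.
Variables (G : groupType) (R : realType).
(* T^G with the product topology. *)
Local Notation torus := {ptws G -> circle R}.
Implicit Types (x : torus) (g : G) (f : G -> int).

Definition lshift g x : torus := fun h => x (g^-1 * h)%g.
Definition rshift g x : torus := fun h => x (h * g)%g.

(* Here f is an element of Z[G], i.e. it has finite support. *)
Definition rho f x : torus :=
  fun h => \sum_(g \in [set: G]) rshift g x h *~ f g.

Definition X_ f : set torus := [set x | rho f x = (fun=> 0)].

Lemma lshift_X f g x : X_ f x -> X_ f (lshift g x).
Proof.
move=> Xx; apply/funext => h; rewrite -[RHS]/((fun=> 0) (g^-1 * h)%g) -Xx.
by rewrite /rho /rshift /lshift; under eq_fsbigr do rewrite mulgA.
Qed.

(* The filter of neighbourhoods of infinity of the discrete group G. *)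
Definition cofinite : set_system G := [set A | cofinite_set A].

Global Instance cofinite_filter : Filter cofinite.
Proof.
split=> [|A B Af Bf|A B AB]; first exact: cofinite_setT.
  by rewrite /cofinite /= setCI finite_setU.
exact: sub_cofinite_set.
Qed.

(* alpha_f is the restriction of lshift to X_ f (see lshift_X), and X_ f has the
   subspace topology, so convergence in X_ f is convergence in the torus. *)
Definition homoclinic f x : Prop :=
  X_ f x /\ (fun g => lshift g x) @ cofinite --> ((fun=> 0) : torus).

Definition summable_point x : Prop :=
  summable [set: G] (fun g => (circle_norm (x g))%:E).

End PrincipalAction.

Section Example.

Definition heis_f : heis -> int :=
  delta 1%g *+ 2 - delta hx^-1%g - delta hy^-1%g.

Lemma heis_f_finite : finite_set [set g | heis_f g != 0].
Proof.
apply: (@sub_finite_set _ _ [set 1%g; hx^-1%g; hy^-1%g]); last first.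
  by rewrite !finite_setU; do ![split]; exact: finite_set1.
move=> g /=; rewrite -[heis_f g]/(delta _ g *+ 2 - delta _ g - delta _ g) /delta.
have [->|_] := eqVneq g 1%g; first by do 2 left.
have [->|_] := eqVneq g hx^-1%g; first by left; right.
by have [->|_] := eqVneq g hy^-1%g; first by right.
Qed.

Variable R : realType.

Definition fstar : heis -> R := star (fun g => (heis_f g)%:~R).

Lemma fstarE : fstar = delta 1%g *+ 2 - delta hx - delta hy.
Proof.
apply/funext => g.
have fctE u v w : ((u *+ 2 - v - w) : heis -> R) g = u g *+ 2 - v g - w g by [].
rewrite fctE /fstar /star -[heis_f _]/(delta _ _ *+ 2 - delta _ _ - delta _ _).
rewrite /delta !(inj_eq invg_inj) -{1}invg1 (inj_eq invg_inj).
by rewrite !rmorphB rmorphMn /= !natz.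
Qed.

(* Pointwise limits; at each element of the group only one term is nonzero. *)
Definition fstar_sharp : heis -> R := fun g =>
  limn (series (fun n => (2 : R) ^- n.+1 * cpow (delta hx + delta hy) n g)).

Definition fstar_sharp_qbinom : heis -> R := fun g =>
  limn (series (fun n => (2 : R) ^- n.+1 * \sum_(k < n.+1)
    gconv (delta (hx ^+ k * hy ^+ (n - k))%g)
         (poly_at (qbinom n k) (delta hz^-1%g)) g)).

(* (1 - z^-1)^2 *)
Definition one_sub_zV_sq : heis -> R := cpow (delta 1%g - delta hz^-1%g) 2.

Definition xbar : {ptws heis -> circle R} :=
  fun g => mod1 (gconv fstar_sharp one_sub_zV_sq g).

End Example.

(* Main.v *)
(* Let s = x + y. At an element of degree n (the sum of the exponents of x and y)
   only the term 2^-(n+1) s^n of the series is nonzero; as s^(n+1) = s s^n = s^n s,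
   the series telescopes to a two-sided inverse of 2 - x - y, and the q-Pascal rule
   gives its q-binomial form.

   For summability it suffices that a(n) = ||(1 - z^-1)^2 s^n||_1 / 2^n has a finite
   sum; write z for z^-1 below. The words x u y and y u x with u of length d - 1
   differ by the factor z^d, so s^(d+1) = P + Q (1 + z^d) where P and Q (1 + z^d)
   each carry half of the mass 2^(d+1). Since ||(1 - u) (1 + u)^j||_1 / 2^j is
   O(j^(-1/2)), this gives ||(1 - z^d) s^((d+1) l)||_1 = O(2^((d+1) l) l^(-1/2)).
   Blocks of length 2 alone (d = 1) only yield a(n) = O(1/n). Combining them with
   long blocks through d (1 - z) = (1 - z^d) + (1 - z)^2 q, ||q||_1 <= d^2, with
   l = d^2 and n of order d^3, yields ||(1 - z) s^n||_1 / 2^n = O(n^(-2/3)), hence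
   a(n) = O(n^(-4/3)) by submultiplicativity.

   An element of the group ring is represented by the operator of left convolution
   by it on functions on the group; it has l^1 norm at most c when the operator is
   bounded by c for the l^1 norm. *)
Require Import Defs.
From HB Require Import structures.
From mathcomp Require Import all_boot all_order all_algebra.
From mathcomp Require Import all_classical all_reals all_analysis.
From mathcomp Require Import ring lra zify.

Set Implicit Arguments.
Unset Strict Implicit.
Unset Printing Implicit Defensive.

Import Order.TTheory GRing.Theory Num.Theory.
Import numFieldNormedType.Exports.

Local Open Scope classical_set_scope.
Local Open Scope ring_scope.

(** * Operators on functions, bounded for the l^1 norm *)

Section Operators.
Variables (G : choiceType) (R : realType).
Implicit Types (v w : G -> R) (c k : R).

(** Duplicate-free sequences range over the finite subsets, so the bound controls the whole,
    possibly infinite, sum without presupposing summability. *)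
Definition l1_le v k := forall s : seq G, uniq s -> \sum_(g <- s) `|v g| <= k.

Lemma l1_leD v w k l : l1_le v k -> l1_le w l -> l1_le (v + w) (k + l).
Proof.
move=> hv hw s us; apply: le_trans (lerD (hv s us) (hw s us)).
by rewrite -big_split; apply: ler_sum => g _; exact: ler_normD.
Qed.

Lemma l1_leN v k : l1_le v k -> l1_le (- v) k.
Proof.
move=> hv s us; apply: le_trans (hv s us).
by apply: ler_sum => g _; rewrite normrN.
Qed.

(** The boolean form of the additivity proof makes it irrelevant, so that operators with equal
    values are equal. *)
Record op := Op { op_fun :> (G -> R) -> G -> R;
                  op_funP : `[< zmod_morphism op_fun >] }.

HB.instance Definition _ := [isSub for op_fun].
HB.instance Definition _ := [Choice of op by <:].

Lemma op_ext (a b : op) : (forall v g, a v g = b v g) -> a = b.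
Proof.
by move=> ab; apply: val_inj; apply/funext => v; apply/funext => g; exact: ab.
Qed.

Lemma op_sub (a : op) v w : a (v - w) = a v - a w.
Proof. by have /asboolP := op_funP a; apply. Qed.

Lemma op_0 (a : op) : a 0 = 0.
Proof. by have := op_sub a 0 0; rewrite !subrr. Qed.

Lemma op_opp (a : op) v : a (- v) = - a v.
Proof. by rewrite -[LHS]/(a (- v)) -sub0r op_sub op_0 sub0r. Qed.

Lemma op_add (a : op) v w : a (v + w) = a v + a w.
Proof. by rewrite -[w in LHS]opprK op_sub op_opp opprK. Qed.

Fact op0P : `[< zmod_morphism (fun _ : G -> R => (0 : G -> R)) >].
Proof. by apply/asboolP => v w; rewrite subr0. Qed.
Fact op1P : `[< zmod_morphism (@id (G -> R)) >].
Proof. by apply/asboolP. Qed.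
Fact oppP (a : op) : `[< zmod_morphism (fun v => - a v) >].
Proof. by apply/asboolP => v w; rewrite op_sub opprB opprK addrC. Qed.
Fact opDP (a b : op) : `[< zmod_morphism (fun v => a v + b v) >].
Proof. by apply/asboolP => v w; rewrite !op_sub opprD addrACA. Qed.
Fact opMP (a b : op) : `[< zmod_morphism (fun v => a (b v)) >].
Proof. by apply/asboolP => v w; rewrite !op_sub. Qed.

Fact op_addA : associative (fun a b => Op (opDP a b)).
Proof. by move=> a b c; apply: op_ext => v g; rewrite /= addrA. Qed.
Fact op_addC : commutative (fun a b => Op (opDP a b)).
Proof. by move=> a b; apply: op_ext => v g; rewrite /= addrC. Qed.
Fact op_add0 : left_id (Op op0P) (fun a b => Op (opDP a b)).
Proof. by move=> a; apply: op_ext => v g; rewrite /= add0r. Qed.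
Fact op_addN : left_inverse (Op op0P) (fun a => Op (oppP a))
  (fun a b => Op (opDP a b)).
Proof. by move=> a; apply: op_ext => v g; rewrite /= addNr. Qed.

HB.instance Definition _ := GRing.isZmodule.Build op
  op_addA op_addC op_add0 op_addN.

Fact op_mulA : associative (fun a b => Op (opMP a b)).
Proof. by move=> a b c; apply: op_ext. Qed.
Fact op_mul1l : left_id (Op op1P) (fun a b => Op (opMP a b)).
Proof. by move=> a; apply: op_ext. Qed.
Fact op_mul1r : right_id (Op op1P) (fun a b => Op (opMP a b)).
Proof. by move=> a; apply: op_ext. Qed.
Fact op_mulDl : left_distributive (fun a b => Op (opMP a b)) +%R.
Proof. by move=> a b c; apply: op_ext. Qed.
Fact op_mulDr : right_distributive (fun a b => Op (opMP a b)) +%R.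
Proof. by move=> a b c; apply: op_ext => v g; rewrite /= op_add. Qed.

HB.instance Definition _ := GRing.Zmodule_isPzRing.Build op
  op_mulA op_mul1l op_mul1r op_mulDl op_mulDr.

Lemma opDE (a b : op) v : (a + b) v = a v + b v. Proof. by []. Qed.
Lemma opME (a b : op) v : (a * b) v = a (b v). Proof. by []. Qed.

Lemma opMnE (a : op) n v : (a *+ n) v = a v *+ n.
Proof. by elim: n => [|n IHn]; rewrite ?mulr0n // !mulrS opDE IHn. Qed.

Definition opb (a : op) c := 0 <= c /\ forall v k, l1_le v k -> l1_le (a v) (c * k).

Lemma l1_le_ge0 v k : l1_le v k -> 0 <= k.
Proof. by move=> /(_ [::] isT); rewrite big_nil. Qed.

Lemma opbW a c d : c <= d -> opb a c -> opb a d.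
Proof.
move=> cd [c0 ac]; split=> [|v k vk s us]; first exact: le_trans cd.
by apply: le_trans (ac _ _ vk s us) _; rewrite ler_wpM2r // (l1_le_ge0 vk).
Qed.

Lemma opb0 : opb 0 0.
Proof. by split=> // v k vk s us; rewrite mul0r big1 // => g _; rewrite normr0. Qed.

Lemma opb1 : opb 1 1.
Proof. by split=> // v k vk; rewrite mul1r. Qed.

Lemma opbD a b c d : opb a c -> opb b d -> opb (a + b) (c + d).
Proof.
move=> [c0 ac] [d0 bd]; split=> [|v k vk]; first exact: addr_ge0.
by rewrite mulrDl; apply: l1_leD; [exact: ac|exact: bd].
Qed.

Lemma opbN a c : opb a c -> opb (- a) c.
Proof. by move=> [c0 ac]; split=> // v k vk; apply/l1_leN/ac. Qed.

Lemma opbB a b c d : opb a c -> opb b d -> opb (a - b) (c + d).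
Proof. by move=> ac bd; apply/opbD/opbN. Qed.

Lemma opbM a b c d : opb a c -> opb b d -> opb (a * b) (c * d).
Proof.
move=> [c0 ac] [d0 bd]; split=> [|v k vk]; first exact: mulr_ge0.
by rewrite -mulrA; apply/ac/bd.
Qed.

Lemma opbX a c n : opb a c -> opb (a ^+ n) (c ^+ n).
Proof.
move=> ac; elim: n => [|n IHn]; first exact: opb1.
by rewrite !exprS; exact: opbM.
Qed.

Lemma opb_sum (I : Type) (r : seq I) (F : I -> op) (c : I -> R) :
  (forall i, opb (F i) (c i)) -> opb (\sum_(i <- r) F i) (\sum_(i <- r) c i).
Proof.
move=> h; elim: r => [|i r IHr]; first by rewrite !big_nil; exact: opb0.
by rewrite !big_cons; exact: opbD.
Qed.

Lemma opbMn a c n : opb a c -> opb (a *+ n) (c *+ n).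
Proof.
move=> ac; elim: n => [|n IHn]; first exact: opb0.
by rewrite !mulrS; exact: opbD.
Qed.

(** Division by [n] takes place in the bound, on pointwise values, so that no scalar operator
    [1 / n] enters the ring. *)
Lemma opb_divn a c n : (0 < n)%N -> opb (a *+ n) c -> opb a (c / n%:R).
Proof.
move=> n0 [c0 ac]; have n0' : 0 < n%:R :> R by rewrite ltr0n.
split=> [|v k vk s us]; first by rewrite divr_ge0 // ltW.
rewrite mulrAC ler_pdivlMr // mulr_suml.
apply: le_trans (ac _ _ vk s us); rewrite opMnE.
rewrite le_eqVlt; apply/orP; left; apply/eqP/eq_bigr => g _.
have -> : (a v *+ n) g = a v g *+ n.
  by elim: n {n0 ac n0'} => // n IHn; rewrite !mulrS -IHn.
by rewrite normrMn mulr_natr.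
Qed.

End Operators.

(** * Decay of differences along the powers of x + y *)

Section BinomialMoments.
Variable R : realType.

(** Variance of a sum of [n] random signs, equal to [n - 2 i] when [i] of them are negative. One
    more sign turns [t] into [t + 1] or [t - 1], and [(t + 1)^2 + (t - 1)^2 = 2 t^2 + 2]. *)
Lemma sum_bin_sqr_dev n : \sum_(i < n.+1) 'C(n, i)%:R * (n%:R - 2 * i%:R) ^+ 2
  = n%:R * 2 ^+ n :> R.
Proof.
pose E n (f : R -> R) := \sum_(i < n.+1) 'C(n, i)%:R * f (n%:R - 2 * i%:R).
(* [E m f] is [2^m] times the expectation of [f] after [m] signs; Pascal's rule conditions on one
   more sign. *)
have ES m f : E m.+1 f = E m (fun t => f (t + 1) + f (t - 1)).
  have e0 (F : nat -> R) : \sum_(i < m.+1) 'C(m, i)%:R * F i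
      = 'C(m, 0)%:R * F 0%N + \sum_(i < m.+1) 'C(m, i.+1)%:R * F i.+1.
    rewrite [in LHS]big_ord_recl [in RHS]big_ord_recr /=.
    by rewrite (bin_small (ltnSn m)) mul0r addr0.
  rewrite /E big_ord_recl.
  under eq_bigr do rewrite /bump /= binS natrD mulrDl.
  have /= e := e0 (fun i => f (m.+1%:R - 2 * i%:R)).
  rewrite big_split /= addrA !bin0 in e *; rewrite -e -big_split /=.
  apply: eq_bigr => i _; rewrite -mulrDr; congr (_ * (f _ + f _)).
    by rewrite -natr1; ring.
  by rewrite -!natr1; ring.
have E1 m : E m (fun=> 1) = 2 ^+ m.
  elim: m => [|m IHm]; first by rewrite /E big_ord1 bin0 mulr1.
  rewrite ES exprSr -IHm /E mulr_suml; apply: eq_bigr => i _; ring.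
rewrite -[LHS]/(E n (fun t => t ^+ 2)); elim: n => [|n IHn].
  by rewrite /E big_ord1 /=; ring.
rewrite ES exprS -natr1 mulrDl mul1r mulrCA -IHn -E1 /E !mulr_sumr -big_split.
by apply: eq_bigr => i _ /=; ring.
Qed.

Lemma sum_bin n : \sum_(i < n.+1) 'C(n, i)%:R = 2 ^+ n :> R.
Proof.
rewrite -[2]/(1 + 1) exprDn; apply: eq_bigr => i _.
by rewrite !expr1n mulr1.
Qed.

(* AM-GM: [2 |t| <= t^2 / sqrt n + sqrt n]. *)
Lemma sum_bin_abs_dev n : \sum_(i < n.+1) 'C(n, i)%:R * `|n%:R - 2 * i%:R|
  <= Num.sqrt n%:R * 2 ^+ n :> R.
Proof.
case: n => [|n]; first by rewrite big_ord1 /= mulr0 subrr normr0 mulr0 mulr_ge0.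
set N := n.+1; set r := Num.sqrt _.
have r0 : 0 < r by rewrite sqrtr_gt0 ltr0n.
have r2 : r ^+ 2 = N%:R by rewrite sqr_sqrtr // ler0n.
rewrite -(ler_pM2l (_ : 0 < 2 * r)) ?mulr_gt0 // mulr_sumr.
apply: (@le_trans _ _ (\sum_(i < N.+1)
  ('C(N, i)%:R * (N%:R - 2 * i%:R) ^+ 2 + r ^+ 2 * 'C(N, i)%:R))); last first.
  rewrite big_split /= sum_bin_sqr_dev -mulr_sumr sum_bin -r2.
  by rewrite le_eqVlt; apply/orP; left; apply/eqP; ring.
apply: ler_sum => i _; rewrite mulrCA [r ^+ 2 * _]mulrC -mulrDr.
apply: ler_wpM2l; first by rewrite ler0n.
rewrite -(real_normK (num_real (_ - _))); move: `|_| => t.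
by have := sqr_ge0 (t - r); lra.
Qed.

End BinomialMoments.

Section HeisenbergRelation.
Variables (G : choiceType) (R : realType).
Implicit Types (u x y z P Q W : op G R).

Lemma opbMz u c (m : int) : opb u c -> opb (u *~ m) (c * `|m|%:~R).
Proof.
move=> uc; have e n : `|Posz n|%:~R = n%:R :> R by rewrite ger0_norm.
case: m => m; rewrite ?NegzE ?mulrNz ?normrN e mulr_natr; last apply: opbN.
  exact: opbMn.
exact: opbMn.
Qed.

(* [n p - 2 u p'] for [p = (1 + u)^n], [n = j.+1]. *)
Lemma bin_derivE u j : ((1 - u) * (1 + u) ^+ j) *+ j.+1 =
  \sum_(i < j.+2) (u ^+ i *+ 'C(j.+1, i)) *~ (j.+1%:Z - 2 * i%:Z).
Proof.
have e : \sum_(i < j.+2) u ^+ i *+ ('C(j.+1, i) * i) = (u * (1 + u) ^+ j) *+ j.+1.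
  rewrite big_ord_recl muln0 mulr0n add0r addrC exprD1n mulr_sumr -sumrMnl.
  apply: eq_bigr => i _.
  by rewrite mulnC -mul_bin_diag mulrnAr -exprS -mulrnA mulnC.
have -> : \sum_(i < j.+2) (u ^+ i *+ 'C(j.+1, i)) *~ (j.+1%:Z - 2 * i%:Z) =
  (\sum_(i < j.+2) u ^+ i *+ 'C(j.+1, i)) *+ j.+1 -
  (\sum_(i < j.+2) u ^+ i *+ ('C(j.+1, i) * i)) *+ 2.
  rewrite -!sumrMnl -sumrB; apply: eq_bigr => i _.
  by rewrite mulrzBr -PoszM -!pmulrn -!mulrnA mulnA mulnAC.
rewrite e -exprD1n (addrC u 1) -mulrnAC -mulrnBl; congr (_ *+ _).
by rewrite exprS -mulrnAl -mulrBl mulr2n opprD addrA addrK.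
Qed.

Definition kappa (a : R) := 2 / Num.sqrt a.

Lemma kappa_ge0 a : 0 <= kappa a.
Proof. by rewrite divr_ge0 // sqrtr_ge0. Qed.

Lemma sqr_kappa a : 0 <= a -> kappa a ^+ 2 = 4 / a.
Proof. by move=> a0; rewrite /kappa expr_div_n sqr_sqrtr // -natrX. Qed.

(** Bounding the mean by the quadratic mean leaves a rational inequality that reduces to [1 <= a].
    Convexity of [kappa] rules out the midpoint shift [1/2]. *)
Lemma kappa_avg a : 1 <= a -> (kappa a + kappa (a + 1)) / 2 <= kappa (a + 3^-1).
Proof.
move=> a1; rewrite -(@ler_pXn2r _ 2) // ?nnegrE ?kappa_ge0 //; last first.
  by rewrite divr_ge0 // addr_ge0 ?kappa_ge0.
apply: (@le_trans _ _ ((kappa a ^+ 2 + kappa (a + 1) ^+ 2) / 2)).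
  by have := sqr_ge0 (kappa a - kappa (a + 1)); lra.
rewrite !sqr_kappa; try lra.
have -> : (4 / a + 4 / (a + 1)) / 2 = (4 * a + 2) / (a * (a + 1)).
  by field; rewrite !gt_eqF //; lra.
rewrite ler_pdivrMr; last by apply: mulr_gt0; lra.
rewrite mulrAC ler_pdivlMr; last by lra.
nra.
Qed.

(** By [bin_derivE] the norm is at most the total absolute deviation divided by [n = j + 1], that is
    [2^n sqrt n / n], which equals [2^j kappa n]. *)
Lemma opb_binom u j : opb u 1 ->
  opb ((1 - u) * (1 + u) ^+ j) (2 ^+ j * kappa j.+1%:R).
Proof.
move=> u1; pose c (i : nat) := 'C(j.+1, i)%:R * `|j.+1%:R - 2 * i%:R| : R.
apply: (@opbW _ _ _ ((\sum_(i < j.+2) c i) / j.+1%:R)); last first.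
  apply: opb_divn => //; rewrite bin_derivE; apply: opb_sum => i.
  have -> : c i = 'C(j.+1, i)%:R * `|j.+1%:Z - 2 * i%:Z|%:~R.
    by rewrite /c intr_norm rmorphB rmorphM.
  by apply: opbMz; rewrite -[in X in opb _ X](expr1n R i); apply/opbMn/opbX.
rewrite ler_pdivrMr ?ltr0n //; apply: le_trans (sum_bin_abs_dev R j.+1) _.
rewrite /kappa exprS; set r := Num.sqrt _.
have r0 : 0 < r by rewrite sqrtr_gt0 ltr0n.
have -> : j.+1%:R = r ^+ 2 by rewrite sqr_sqrtr // ler0n.
by rewrite le_eqVlt; apply/orP; left; apply/eqP; field; rewrite gt_eqF.
Qed.

(* Expanding [W^m], the number of factors [1 + u] collected is a binomial variable
   with parameters [m] and [1/2]; by [kappa_avg] the averaged bound behaves as if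
   that number were [m / 3]. *)
Lemma opb_mix u P Q W (w : R) : GRing.comm P u -> GRing.comm Q u ->
  W = P + Q * (1 + u) -> opb u 1 -> opb P (w / 2) -> opb Q (w / 4) ->
  forall m j, opb ((1 - u) * (1 + u) ^+ j * W ^+ m)
    (2 ^+ j * w ^+ m * kappa (j.+1%:R + m%:R / 3)).
Proof.
move=> Pu Qu WE u1 Pw Qw.
have w0 : 0 <= w by have [+ _] := Pw; lra.
have cu b k : GRing.comm b u -> GRing.comm b ((1 - u) * (1 + u) ^+ k).
  move=> bu; apply: commrM; first by apply: commrB => //; exact: commr1.
  by apply/commrX/commrD => //; exact: commr1.
elim=> [|m IHm] j; first by rewrite !mulr1 mul0r addr0; exact: opb_binom.
(* One factor [W] is expanded: [P] moves to the front, while [Q] does so and leaves its factor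
   [1 + u] to the power. *)
have -> : (1 - u) * (1 + u) ^+ j * W ^+ m.+1 =
  P * ((1 - u) * (1 + u) ^+ j * W ^+ m) + Q * ((1 - u) * (1 + u) ^+ j.+1 * W ^+ m).
  rewrite exprS {1}WE !mulrA mulrDr mulrDl !mulrA; congr (_ + _).
    by rewrite -(cu P j Pu) !mulrA.
  have -> : (1 - u) * (1 + u) ^+ j * Q * (1 + u) = Q * (1 - u) * (1 + u) ^+ j.+1.
    rewrite -(cu Q j Qu) -!mulrA; do 2 congr (_ * _).
    by rewrite exprSr.
  by [].
have k0 i : 0 <= kappa (i.+1%:R + m%:R / 3) := kappa_ge0 _.
apply: opbW (opbD (opbM Pw (IHm j)) (opbM Qw (IHm j.+1))).
have /kappa_avg : 1 <= j.+1%:R + m%:R / 3 :> R.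
  by apply: ler_wpDr; [rewrite divr_ge0|rewrite ler1n].
rewrite -(natr1 j.+1) -(natr1 m) (mulrDl m%:R) mul1r addrA (addrAC _ 1) => h.
(* The extra factor 2 in [2 ^+ j.+1] turns the mass [w / 4] of [Q] into [w / 2]: both branches weigh
   the same, as [kappa_avg] requires. *)
have -> : w / 2 * (2 ^+ j * w ^+ m * kappa (j.+1%:R + m%:R / 3)) +
   w / 4 * (2 ^+ j.+1 * w ^+ m * kappa (j.+1%:R + m%:R / 3 + 1)) =
   2 ^+ j * w ^+ m.+1 *
     ((kappa (j.+1%:R + m%:R / 3) + kappa (j.+1%:R + m%:R / 3 + 1)) / 2).
  by rewrite !exprS; field.
by apply: ler_wpM2l h; rewrite mulr_ge0 ?exprn_ge0.
Qed.

(** * Second differences of powers of [x + y] when [y x = z x y] with [z] central *)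

Section Relation.
Variables x y z : op G R.
Hypotheses (x1 : opb x 1) (y1 : opb y 1) (z1 : opb z 1).
Hypotheses (zx : GRing.comm z x) (zy : GRing.comm z y) (yx : y * x = z * (x * y)).
Local Notation s := (x + y).

Lemma opb_sX n : opb (s ^+ n) (2 ^+ n).
Proof. by apply: opbX; rewrite -[2]/(1 + 1); exact: opbD. Qed.

Lemma opb_zX n : opb (z ^+ n) 1.
Proof. by rewrite -(expr1n R n); exact: opbX. Qed.

Lemma comm_zXs d n : GRing.comm (z ^+ d) (s ^+ n).
Proof. by apply/commrX/commr_sym/commrX/commr_sym/commrD. Qed.

(* Exchanging the first and last letters of a word with [m.+2] letters multiplies
   it by the same power of [z], whatever the letters in between. *)
Lemma swap_ends m : y * s ^+ m * x = x * s ^+ m * y * z ^+ m.+1.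
Proof.
(* What [s] becomes when [y] passes over it: [y s = t y]; moreover [t x = z x s]. *)
pose t := z * x + y.
have ys : y * s = t * y by rewrite mulrDr mulrDl yx mulrA.
have tx : t * x = z * x * s by rewrite mulrDl yx mulrDr !mulrA.
have yS : y * s ^+ m = t ^+ m * y.
  elim: m => [|m IHm]; first by rewrite mulr1 mul1r.
  by rewrite exprSr mulrA IHm -mulrA ys mulrA -exprSr.
have zt k : GRing.comm (z ^+ k) t.
  by apply/commr_sym/commrX/commr_sym/commrD => //; apply: commrM.
have tX : t ^+ m * x = z ^+ m * x * s ^+ m.
  elim: m {yS} => [|m IHm]; first by rewrite !expr0 mulr1.
  rewrite exprS -mulrA IHm !mulrA -(zt m) -(mulrA _ t x) tx !mulrA -exprSr.
  by rewrite -mulrA -exprS.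
rewrite yS -mulrA yx mulrA -(commrX m (zt 1)) expr1 -mulrA (mulrA _ x) tX.
have <- : GRing.comm (z ^+ m.+1) (x * s ^+ m * y).
  apply: commrM; first apply: commrM; last exact/commr_sym/commrX/commr_sym.
    exact/commr_sym/commrX/commr_sym.
  exact: comm_zXs.
by rewrite exprS !mulrA.
Qed.

(** [opb_mix] with [u = z ^+ d.+1], applied to words of [d.+2] letters: those with equal end letters
    form [P], half of the mass; the others form [Q (1 + u)] by [swap_ends]. *)
Lemma opb_block d k : opb ((1 - z ^+ d.+1) * s ^+ (d.+2 * k))
  (2 ^+ (d.+2 * k) * kappa (1 + k%:R / 3)).
Proof.
have xsy := opbM (opbM x1 (opb_sX d)) y1; rewrite mulr1 mul1r in xsy.
have cz a : GRing.comm z a -> GRing.comm a (z ^+ d.+1).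
  by move=> za; apply/commrX/commr_sym.
have cs : GRing.comm z (s ^+ d) by apply/commrX/commrD.
have h := @opb_mix (z ^+ d.+1) (x * s ^+ d * x + y * s ^+ d * y) (x * s ^+ d * y)
  (s ^+ d.+2) (2 ^+ d.+2).
rewrite !exprM -[2 ^+ _ ^+ k]mul1r -[1 - _]mulr1.
apply: (h _ _ _ _ _ _ k 0).
- by apply: cz; apply: commrD; do 2?apply: commrM.
- by apply: cz; do 2?apply: commrM.
- rewrite mulrDr mulr1 -swap_ends exprS exprSr !mulrDl !mulrDr !mulrA.
  by rewrite [X in _ + X = _]addrC addrACA.
- exact: opb_zX.
- have := opbD (opbM (opbM x1 (opb_sX d)) x1) (opbM (opbM y1 (opb_sX d)) y1).
  rewrite !mul1r !mulr1; apply: opbW; rewrite !exprS; lra.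
- by apply: opbW xsy; rewrite !exprS; lra.
Qed.

(* Replaces [1 - z] by [(1 - z^d) / d], at the cost of a second difference. *)
Lemma diff1_mul d : exists2 q : op G R, opb q (d%:R ^+ 2) &
  (1 - z) *+ d = 1 - z ^+ d + q * ((1 - z) * (1 - z)).
Proof.
have geo n : (\sum_(i < n) z ^+ i) * (1 - z) = 1 - z ^+ n.
  have -> : 1 - z ^+ n = (1 - z) * \sum_(i < n) z ^+ i.
    by rewrite -[LHS]opprB subrX1 -mulNr opprB.
  apply/commr_sym/commr_sum => i _; apply/commrX/commr_sym.
  by apply: commrB; first exact: commr1.
(* From [d - (1 + ... + z^(d-1))], which is the sum of the [1 - z^i], each a multiple of [1 - z]. *)
exists (\sum_(i < d) \sum_(k < i) z ^+ k).
  apply: (@opbW _ _ _ (\sum_(i < d) \sum_(k < i) 1)); last first.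
    by do 2!apply: opb_sum => ?; exact: opb_zX.
  apply: (@le_trans _ _ (\sum_(i < d) d%:R)); last first.
    by rewrite sumr_const card_ord expr2 mulr_natr.
  by apply: ler_sum => i _; rewrite sumr_const card_ord ler_nat ltnW.
rewrite mulrA mulr_suml; under eq_bigr do rewrite geo.
rewrite sumrB mulrBl geo sumr_const card_ord mulrnAl mul1r.
by rewrite [RHS]addrC subrK.
Qed.

(** After [diff1_mul], the run of [d.+1 * l] letters damps [1 - z ^+ d] in [l] blocks, and each run
    of [2 * k] letters damps one factor of [(1 - z) * (1 - z)] in blocks of length 2. The letters
    left over only contribute their mass. *)
Lemma opb_diff1 d k l n : (0 < d)%N -> n = (2 * k + 2 * k + d.+1 * l)%N ->
  opb ((1 - z) * s ^+ n)
    (2 ^+ n * ((kappa (1 + l%:R / 3) + d%:R ^+ 2 * kappa (1 + k%:R / 3) ^+ 2)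
       / d%:R)).
Proof.
case: d => // d _ ->; have [q qb qE] := diff1_mul d.+1.
rewrite [_ * (_ / _)]mulrA; apply: opb_divn => //.
rewrite -mulrnAl qE mulrDl.
set e := (2 * k)%N; set m := (_ * l)%N.
have cz1 r : GRing.comm (s ^+ r) (1 - z).
  apply/commrB; first exact: commr1.
  by apply/commr_sym; rewrite -[z]expr1; exact: comm_zXs.
have -> : (1 - z ^+ d.+1) * s ^+ (e + e + m) =
    (1 - z ^+ d.+1) * s ^+ m * s ^+ (e + e) by rewrite -mulrA -exprD addnC.
have -> : q * ((1 - z) * (1 - z)) * s ^+ (e + e + m) =
    q * (((1 - z) * s ^+ e) * ((1 - z) * s ^+ e) * s ^+ m).
  rewrite -mulrA (exprD _ (e + e)) (exprD _ e) !mulrA -(mulrA _ (s ^+ e) (1 - z)).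
  by rewrite cz1 !mulrA.
have b1 := opb_block 0 k; rewrite expr1 -/e in b1.
apply: opbW (opbD (opbM (opb_block d l) (opb_sX (e + e)))
  (opbM qb (opbM (opbM b1 b1) (opb_sX m)))).
by rewrite -/m (exprD _ (e + e)) (exprD _ e) le_eqVlt; apply/orP; left; apply/eqP; ring.
Qed.

Lemma kappa_bound (D : nat) : (0 < D)%N ->
  kappa (1 + (D ^ 2)%:R / 3) <= 4 / D%:R /\
  kappa (1 + (D ^ 3)%:R / 3) ^+ 2 <= 12 / D%:R ^+ 3.
Proof.
move=> D0; have r0 : 0 < D%:R :> R by rewrite ltr0n.
split; last first.
  rewrite sqr_kappa; last by rewrite addr_ge0 // divr_ge0.
  rewrite natrX; have := exprn_gt0 3 r0; set t := _ ^+ 3 => t0.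
  rewrite ler_pdivrMr; last by lra.
  rewrite mulrAC ler_pdivlMr //; nra.
rewrite -(@ler_pXn2r _ 2) // ?nnegrE ?kappa_ge0 ?divr_ge0 //.
rewrite sqr_kappa; last by rewrite addr_ge0 // divr_ge0.
rewrite natrX expr_div_n; have := exprn_gt0 2 r0; set t := _ ^+ 2 => t0.
rewrite ler_pdivrMr; last by lra.
rewrite mulrAC ler_pdivlMr //; nra.
Qed.

(* [opb_diff1] with [d = D], [l = D^2], [k = D^3]. *)
Lemma opb_diff1_large (D n : nat) : (0 < D)%N -> (6 * D ^ 3 <= n)%N ->
  opb ((1 - z) * s ^+ n) (2 ^+ n * (16 / D%:R ^+ 2)).
Proof.
move=> D0 Dn; have r0 : 0 < D%:R :> R by rewrite ltr0n.
(* The constant 6 comes from [D.+1 * D ^ 2 <= 2 * D ^ 3]; letters beyond [n0] contribute only their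
   mass. *)
set n0 := (2 * D ^ 3 + 2 * D ^ 3 + D.+1 * D ^ 2)%N.
have n0n : (n0 <= n)%N.
  apply: leq_trans Dn; rewrite {}/n0; have : (D ^ 2 <= D ^ 3)%N by rewrite leq_pexp2l.
  have : (D ^ 3 = D * D ^ 2)%N by rewrite expnS.
  by move: (D ^ 2)%N (D ^ 3)%N => a b; nia.
rewrite -(subnKC n0n) !(exprD _ n0) [X in opb X]mulrA [X in opb _ X]mulrAC.
apply: opbW (opbM (opb_diff1 D0 (erefl n0)) (opb_sX _)).
rewrite ler_wpM2r ?exprn_ge0 // ler_wpM2l ?exprn_ge0 // ler_pdivrMr //.
have [h2 h3] := kappa_bound D0.
have -> : 16 / D%:R ^+ 2 * D%:R = 4 / D%:R + D%:R ^+ 2 * (12 / D%:R ^+ 3) :> R.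
  by field; rewrite gt_eqF.
by apply: lerD => //; apply: ler_wpM2l => //; exact/exprn_ge0/ltW.
Qed.

(** The power of [s] is cut into two runs of at least [6 * D ^ 3] letters, one for each factor
    [1 - z]; hence [256 = 16^2]. *)
Lemma opb_diff2 (D n : nat) : (0 < D)%N -> (12 * D ^ 3 <= n)%N ->
  opb ((1 - z) ^+ 2 * s ^+ n) (2 ^+ n * (256 / D%:R ^+ 4)).
Proof.
move=> D0 Dn; have r0 : 0 < D%:R :> R by rewrite ltr0n.
have ? : (6 * D ^ 3 <= n)%N by lia.
set m := (6 * D ^ 3)%N; rewrite -(@subnKC m n) //.
have cz1 : GRing.comm (s ^+ m) (1 - z).
  apply/commrB; first exact: commr1.
  by apply/commr_sym; rewrite -[z]expr1; exact: comm_zXs.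
rewrite !(exprD _ m) expr2 -mulrA (mulrA _ (s ^+ m)) -cz1 -(mulrA (s ^+ m)) !mulrA.
rewrite -(mulrA _ (1 - z)).
have n2 : (6 * D ^ 3 <= n - m)%N by rewrite /m; lia.
apply: opbW (opbM (opb_diff1_large D0 (leqnn _)) (opb_diff1_large D0 n2)).
by rewrite le_eqVlt; apply/orP; left; apply/eqP; field; rewrite gt_eqF.
Qed.

Lemma opb_diff2_summable : exists2 c : nat -> R,
  (forall n, opb ((1 - z) ^+ 2 * s ^+ n) (2 ^+ n * c n)) &
  exists K, forall N, \sum_(n < N) c n <= K.
Proof.
pose t n := trunc_log 8 (n %/ 12).
(* [opb_diff2] with [D = 2 ^ t n]; the bounds are then summed over the
   blocks [12 * 8^k <= n < 12 * 8^k.+1], where [t n = k]. *)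
exists (fun n => 256 / 16 ^+ t n) => [n|].
  (* For [n < 12] the truncated logarithm is 0, and the trivial bound [2^2] is below 256. *)
  have [n12|n12] := ltnP n 12.
    rewrite /t divn_small // trunc_log0 divr1.
    have z2 := opbX 2 (opbB (opb1 G R) z1).
    apply: opbW (opbM z2 (opb_sX n)); rewrite mulrC ler_wpM2l ?exprn_ge0 //.
    by rewrite -[1 + 1]/(2%:R) -natrX ler_nat.
  have -> : 16 ^+ t n = (2 ^ t n)%:R ^+ 4 :> R.
    by rewrite natrX -!natrX -expnM mulnC expnM.
  apply: opb_diff2; first by rewrite expn_gt0.
  rewrite -expnM mulnC (mulnC (t n)) expnM.
  have : (8 ^ t n <= n %/ 12)%N by apply: trunc_logP => //; rewrite divn_gt0.
  by rewrite leq_divRL.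
pose S k : R := \sum_(n < 12 * 8 ^ k) 256 / 16 ^+ t n.
have S_le a b : (a <= b)%N ->
    \sum_(n < b) 256 / 16 ^+ t n =
    \sum_(n < a) 256 / 16 ^+ t n + \sum_(a <= n < b) 256 / 16 ^+ t n :> R.
  by move=> ab; rewrite -!(big_mkord xpredT (fun n => 256 / 16 ^+ t n)) -big_cat_nat.
have c0 n : 0 <= 256 / 16 ^+ t n :> R by rewrite divr_ge0 // exprn_ge0.
(* The block has [84 * 8^k] indices, each with bound [256 / 16^k]: a geometric series of ratio
   [1/2]. *)
have SS k : S k.+1 = S k + 84 * 256 / 2 ^+ k.
  have kk : (12 * 8 ^ k <= 12 * 8 ^ k.+1)%N by rewrite leq_mul2l /= leq_pexp2l.
  rewrite /S (S_le _ _ kk); congr (_ + _).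
  rewrite (@eq_big_nat _ _ _ _ _ _ (fun=> 256 / 16 ^+ k)) => [|n /andP[n1 n2]].
    rewrite sumr_const_nat.
    have -> : (12 * 8 ^ k.+1 - 12 * 8 ^ k = 84 * 8 ^ k)%N by rewrite expnS; lia.
    have -> : 16 ^+ k = 2 ^+ k * 8 ^+ k :> R by rewrite -exprMn; congr (_ ^+ _); ring.
    rewrite -[LHS]mulr_natr natrM natrX.
    by field; rewrite !expf_neq0.
  congr (_ / _ ^+ _); apply: trunc_log_eq => //.
  by rewrite leq_divRL // ltn_divLR // mulnC n1 mulnC.
have SE k : S k = 12 * 256 + 84 * 256 * (2 - 2 / 2 ^+ k).
  elim: k => [|k IHk]; last first.
    by rewrite SS IHk exprS; field; rewrite expf_neq0.
  rewrite /S expn0 muln1 (eq_bigr (fun=> 256)) => [|i _].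
    by rewrite sumr_const card_ord -mulr_natr; field.
  by rewrite /t divn_small // trunc_log0 divr1.
exists (12 * 256 + 84 * 256 * 2) => N.
apply: (@le_trans _ _ (S N)); last first.
  rewrite SE; have : 0 < 2 / 2 ^+ N :> R by rewrite divr_gt0 // exprn_gt0.
  by move: (2 / _) => e e0; lra.
have NN : (N <= 12 * 8 ^ N)%N.
  by have := @ltn_expl 8 N isT; lia.
by rewrite /S (S_le _ _ NN) lerDl; apply: sumr_ge0.
Qed.
End Relation.
End HeisenbergRelation.

(** * Convolution by finitely supported functions *)

Section Convolution.

(** A sum over [[set: T]] defaults to 0 on infinite support; here the first components of [r]
    contain the support. They may repeat, so presenting a function by such a list needs no
    distinctness of the points. *)
Lemma fsum_pick (T : choiceType) (V : nmodType) (r : seq (T * V)) :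
  \sum_(d \in [set: T]) \sum_(p <- r) (if d == p.1 then p.2 else 0)
  = \sum_(p <- r) p.2.
Proof.
have -> : [set: T] = [set` (xpredT : pred T)] by apply/seteqP; split.
rewrite -(@bigfs _ _ _ _ (undup [seq p.1 | p <- r])) ?undup_uniq //; last first.
  move=> d _; rewrite mem_undup => dr; rewrite big_seq big1 // => p pr.
  by case: eqP => // dp; case/negP: dr; rewrite dp map_f.
rewrite exchange_big /= big_seq [RHS]big_seq; apply: eq_bigr => p pr.
rewrite -big_mkcond /= -big_filter.
rewrite (@eq_filter _ _ (pred1 p.1)); last by [].
by rewrite filter_pred1_uniq ?undup_uniq ?mem_undup ?map_f // big_seq1.
Qed.

Variables (G : groupType) (K : nzRingType).
Implicit Types (v w : G -> K) (g h : G).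

Lemma fsum_lincomb (r : seq (K * G)) (F : G -> K) :
  \sum_(d \in [set: G]) (\sum_(p <- r) p.1 * (d == p.2)%:R) * F d =
  \sum_(p <- r) p.1 * F p.2.
Proof.
rewrite -[RHS](big_map (fun p : K * G => (p.2, p.1 * F p.2)) xpredT snd) -fsum_pick.
apply: eq_fsbigr => d _; rewrite big_map mulr_suml; apply: eq_bigr => p _ /=.
by case: eqP => [->|_]; rewrite ?mulr1 // mulr0 mul0r.
Qed.

Lemma gconv_lincombl (r : seq (K * G)) v w g :
  (forall d, v d = \sum_(p <- r) p.1 * (d == p.2)%:R) ->
  gconv v w g = \sum_(p <- r) p.1 * w (p.2^-1 * g)%g.
Proof.
move=> vE; rewrite -(fsum_lincomb r (fun d => w (d^-1 * g)%g)).
by apply: eq_fsbigr => d _; rewrite vE.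
Qed.

End Convolution.

Lemma gconv_lincombr (G : groupType) (K : comNzRingType) (r : seq (K * G))
    (v w : G -> K) (g : G) :
  (forall d, w d = \sum_(p <- r) p.1 * (d == p.2)%:R) ->
  gconv v w g = \sum_(p <- r) p.1 * v (g * p.2^-1)%g.
Proof.
move=> wE.
rewrite -[RHS](big_map (fun p : K * G => (p.1, (g * p.2^-1)%g)) xpredT
  (fun p : K * G => p.1 * v p.2)) -fsum_lincomb.
apply: eq_fsbigr => d _; rewrite wE mulrC big_map; congr (_ * _).
apply: eq_bigr => p _ /=; congr (_ * (_ : bool)%:R).
apply/eqP/eqP => [<-|->]; rewrite invgM invgK; first by rewrite mulgA mulgV mul1g.
by rewrite -mulgA mulVg mulg1.
Qed.

Section Translation.
Variables (G : groupType) (R : realType).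
Implicit Types (v w : G -> R) (g h : G).

Fact translateP h : `[< zmod_morphism (fun v (g : G) => v (h^-1 * g)%g) >].
Proof. by apply/asboolP. Qed.
(* Left convolution by [delta h]. *)
Definition translate h : op G R := Op (translateP h).

Lemma translateE h v g : translate h v g = v (h^-1 * g)%g. Proof. by []. Qed.

Lemma translateM h k : translate (h * k)%g = translate h * translate k.
Proof. by apply: op_ext => v g; rewrite opME !translateE invgM mulgA. Qed.

Lemma opb_translate h : opb (translate h) 1.
Proof.
split=> // v k vk s us; rewrite mul1r.
rewrite -(big_map (fun g => h^-1 * g)%g xpredT (fun g => `|v g|)).
by apply: vk; rewrite map_inj_uniq //; exact: mulgI.
Qed.

Lemma l1_le_delta h : l1_le (delta h : G -> R) 1.
Proof.
move=> s us; rewrite (eq_bigr (fun g => if g == h then 1 else 0)) => [|g _].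
  rewrite -big_mkcond -big_filter (@eq_filter _ _ (pred1 h)) //.
  have [hs|hs] := boolP (h \in s); first by rewrite filter_pred1_uniq // big_seq1.
  rewrite (_ : seq.filter _ _ = [::]) ?big_nil //.
  by apply/eqP; rewrite -(negbK (_ == _)) -has_filter has_pred1.
by rewrite /delta; case: eqP; rewrite ?normr1 ?normr0.
Qed.

Lemma l1_le_summable v k : l1_le v k -> summable [set: G] (EFin \o v).
Proof.
move=> vk; rewrite /summable (@le_lt_trans _ _ k%:E) ?ltry //.
apply: ge_ereal_sup => _ [A [Af _] <-].
rewrite fsbig_finite //= sumEFin lee_fin; exact: vk.
Qed.

End Translation.

(** * The formal inverse *)

Section Degree.

(** The homomorphism to the integers that sends x and y to 1 and z to 0. *)
Definition heis_deg (g : heis) : int :=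
  g (@Ordinal 3 0 isT) (@Ordinal 3 1 isT) + g (@Ordinal 3 1 isT) (@Ordinal 3 2 isT).

Lemma heis_surj (g : heis) : exists a b c, g = heis_of a b c.
Proof. by do 3!eexists; exact: heisE. Qed.

Lemma heis_deg_of a b c : heis_deg (heis_of a b c) = a + b.
Proof. by rewrite /heis_deg; have [-> -> _] := heis_ofK a b c. Qed.

Lemma heis_degM g h : heis_deg (g * h)%g = heis_deg g + heis_deg h.
Proof.
have [a [b [c ->]]] := heis_surj g; have [a' [b' [c' ->]]] := heis_surj h.
by rewrite heis_ofM !heis_deg_of addrACA.
Qed.

Lemma heis_degV g : heis_deg g^-1%g = - heis_deg g.
Proof.
by have [a [b [c ->]]] := heis_surj g; rewrite heis_ofV !heis_deg_of opprD.
Qed.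

Lemma heis_deg1 : heis_deg 1%g = 0. Proof. by rewrite -heis_of1 heis_deg_of. Qed.
Lemma heis_degx : heis_deg hx = 1. Proof. by rewrite heis_deg_of addr0. Qed.
Lemma heis_degy : heis_deg hy = 1. Proof. by rewrite heis_deg_of add0r. Qed.
Lemma heis_degz : heis_deg hz = 0. Proof. by rewrite hzE heis_deg_of. Qed.

Lemma hz_central g : (hz * g = g * hz)%g.
Proof.
have [a [b [c ->]]] := heis_surj g; rewrite hzE !heis_ofM.
by congr heis_of; ring.
Qed.

Lemma hzV_central g : (hz^-1 * g = g * hz^-1)%g.
Proof. by rewrite -[g in LHS](mulgK hz) -hz_central -mulgA mulKg. Qed.

Lemma hy_hx : (hy * hx = hz^-1 * (hx * hy))%g.
Proof. by rewrite hzE heis_ofV !heis_ofM; congr heis_of; ring. Qed.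

End Degree.

Lemma eq_mulVg1 (G : groupType) (g h : G) : (h^-1 * g == 1)%g = (g * h^-1 == 1)%g.
Proof.
apply/eqP/eqP => e; first by rewrite -[g](mulVKg h) e mulg1 mulgV.
by rewrite -[g](mulgVK h) e mul1g mulVg.
Qed.

Section FormalInverse.
Variable R : realType.
Implicit Types (v w : heis -> R) (g h : heis).

Definition words n : heis -> R := cpow (delta hx + delta hy) n.

Lemma delta_xyE d : (delta hx + delta hy : heis -> R) d =
  \sum_(p <- [:: (1, hx); (1, hy)]) p.1 * (d == p.2)%:R.
Proof. by rewrite !big_cons big_nil !mul1r addr0. Qed.

Lemma wordsS n g : words n.+1 g = words n (hx^-1 * g)%g + words n (hy^-1 * g)%g.
Proof.
rewrite [LHS](gconv_lincombl _ _ delta_xyE).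
by rewrite !big_cons big_nil !mul1r addr0.
Qed.

(** [cpow] multiplies on the left; the two sides agree because left and right translations
    commute. *)
Lemma wordsSr n g : words n.+1 g = words n (g * hx^-1)%g + words n (g * hy^-1)%g.
Proof.
elim: n g => [|n IHn] g.
  by rewrite wordsS /words /= /delta !eq_mulVg1.
rewrite wordsS (IHn (hx^-1 * g)%g) (IHn (hy^-1 * g)%g).
by rewrite (wordsS n (g * hx^-1)%g) (wordsS n (g * hy^-1)%g) !mulgA addrACA.
Qed.

Lemma words_ge0 n g : 0 <= words n g.
Proof.
elim: n g => [|n IHn] g; first exact: ler0n.
by rewrite wordsS addr_ge0.
Qed.

Lemma words_le n g : words n g <= 2 ^+ n.
Proof.
elim: n g => [|n IHn] g; first by rewrite expr0 /words /= /delta; case: eqP.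
by rewrite wordsS exprS mulr_natl mulr2n lerD.
Qed.

Lemma words_deg n g : heis_deg g != n%:Z -> words n g = 0.
Proof.
elim: n g => [|n IHn] g gn.
  rewrite /words /= /delta; case: eqP => // g1.
  by rewrite g1 heis_deg1 eqxx in gn.
rewrite wordsS !IHn ?addr0 // heis_degM heis_degV ?heis_degx ?heis_degy.
  by apply: contra gn => /eqP e; apply/eqP; lia.
by apply: contra gn => /eqP e; apply/eqP; lia.
Qed.

Definition sharp_term n g : R := 2 ^- n.+1 * words n g.

(** [words n g] vanishes unless [n] is the degree of [g], so the partial sums are constant from [N]
    on and [limn] is a genuine limit. *)
Lemma fstar_sharp_sum g (N : nat) : heis_deg g < N%:Z ->
  fstar_sharp R g = \sum_(n < N) sharp_term n g.
Proof.
move=> gN; apply: lim_near_cst; first exact: Rhausdorff.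
exists N => // M /= NM; rewrite /series /=.
rewrite -(big_mkord xpredT (fun n => sharp_term n g)).
rewrite (big_cat_nat (leq0n N) NM) /= [X in _ + X]big_nat [X in _ + X]big1 ?addr0 //.
move=> n /andP[Nn _]; rewrite -/(words n) words_deg ?mulr0 //.
by apply/eqP => e; move: gN Nn; rewrite e; lia.
Qed.

Lemma fstar_sharp_bounded : bounded_fun (fstar_sharp R).
Proof.
exists 2^-1; split => // M M1 g _ /=; apply: le_trans (ltW M1).
have bd n : 0 <= sharp_term n g <= 2^-1.
  rewrite /sharp_term; apply/andP; split.
    by rewrite mulr_ge0 ?words_ge0 ?invr_ge0 ?exprn_ge0.
  by rewrite mulrC ler_pdivrMr ?exprn_gt0 // exprS mulrA mulVf ?mul1r ?words_le.
case gE : (heis_deg g) => [n|n]; last first.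
  by rewrite (@fstar_sharp_sum _ 0) ?gE // big_ord0 normr0.
rewrite (@fstar_sharp_sum _ n.+1) ?gE; last by lia.
rewrite big_ord_recr big1 /=; last first.
  by move=> i _; rewrite /sharp_term words_deg ?mulr0 // gE; have := ltn_ord i; lia.
by have /andP[b0 b1] := bd n; rewrite add0r ger0_norm.
Qed.

(** [l] and [r] stand for [g] stripped of a letter x or y, on either side, so both halves of the
    inverse follow. Cutting the sum for [g] one term later than the others cancels all but its term
    [n = 0]. *)
Lemma fstar_sharp_telescope g l r :
  heis_deg l < heis_deg g -> heis_deg r < heis_deg g ->
  (forall n, words n.+1 g = words n l + words n r) ->
  2 * fstar_sharp R g - fstar_sharp R l - fstar_sharp R r = delta 1%g g.
Proof.
move=> lg rg gE; have [N gN] : exists n : nat, heis_deg g < n%:Z.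
  by exists (absz (heis_deg g)).+1; lia.
rewrite (@fstar_sharp_sum g N.+1) ?(@fstar_sharp_sum l N)
  ?(@fstar_sharp_sum r N); try lia.
rewrite -addrA -opprD -big_split /= mulr_sumr big_ord_recl -addrA -sumrB.
rewrite big1 => [|i _]; first by rewrite addr0 /sharp_term mulrA expr1 divff ?mul1r.
rewrite /sharp_term [words (lift _ _) g]gE -mulrDr mulrA.
by rewrite [in X in X - _]exprS invfM mulrA divff // mul1r subrr.
Qed.

Lemma fstar_lincomb d : fstar R d =
  \sum_(p <- [:: (2, 1%g); (-1, hx); (-1, hy)]) p.1 * (d == p.2)%:R.
Proof.
rewrite fstarE !big_cons big_nil /= !mulN1r addr0 mulr_natl addrA.
by rewrite -[LHS]/(delta _ _ *+ 2 - delta _ _ - delta _ _) /delta.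
Qed.

Lemma fstar_sharp_mulr g : 2 * fstar_sharp R g - fstar_sharp R (g * hx^-1)%g
  - fstar_sharp R (g * hy^-1)%g = delta 1%g g.
Proof.
by apply: fstar_sharp_telescope => [||n]; rewrite ?wordsSr // heis_degM heis_degV
  ?heis_degx ?heis_degy ltrBlDr ltrDl.
Qed.

Lemma fstar_sharp_mull g : 2 * fstar_sharp R g - fstar_sharp R (hx^-1 * g)%g
  - fstar_sharp R (hy^-1 * g)%g = delta 1%g g.
Proof.
by apply: fstar_sharp_telescope => [||n]; rewrite ?wordsS // heis_degM heis_degV
  ?heis_degx ?heis_degy addrC ltrBlDr ltrDl.
Qed.

Lemma fstar_sharp_inverse : formal_inverse (fstar_sharp R) (fstar R).
Proof.
split; apply/funext => g.
  rewrite (gconv_lincombr _ _ fstar_lincomb) !big_cons big_nil /=.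
  by rewrite addr0 !mulN1r addrA invg1 mulg1 fstar_sharp_mulr.
rewrite (gconv_lincombl _ _ fstar_lincomb) !big_cons big_nil /=.
by rewrite addr0 !mulN1r addrA invg1 mul1g fstar_sharp_mull.
Qed.

Lemma one_sub_zV_lincomb d : (delta 1%g - delta hz^-1%g : heis -> R) d =
  \sum_(p <- [:: (1, 1%g); (-1, hz^-1%g)]) p.1 * (d == p.2)%:R.
Proof. by rewrite !big_cons big_nil mul1r mulN1r addr0. Qed.

Lemma one_sub_zV_sq_lincomb d : one_sub_zV_sq R d =
  \sum_(p <- [:: (1, 1%g); (-2, hz^-1%g); (1, (hz^-1 * hz^-1)%g)])
    p.1 * (d == p.2)%:R.
Proof.
rewrite [LHS](gconv_lincombl _ _ one_sub_zV_lincomb) !big_cons big_nil /= !addr0.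
rewrite !(gconv_lincombl _ _ one_sub_zV_lincomb) !big_cons !big_nil /= !addr0.
have zE h k : (hz * h == k)%g = (h == hz^-1 * k)%g.
  by apply/eqP/eqP => [<-|->]; rewrite ?mulKg ?mulVKg.
rewrite invg1 invgK !mul1g /delta !zE mulg1.
ring.
Qed.

(** The product of [v] with [(1 - z^-1)^2], on the left or on the right since [hz] is central. *)
Definition diff2 v : heis -> R :=
  fun g => v g - 2 * v (hz * g)%g + v (hz * (hz * g))%g.

Lemma gconv_diff2l v g : gconv (one_sub_zV_sq R) v g = diff2 v g.
Proof.
rewrite (gconv_lincombl _ _ one_sub_zV_sq_lincomb) !big_cons big_nil /= addr0.
by rewrite invg1 mul1g !mul1r (invgM hz^-1%g hz^-1%g) !invgK mulNr -(mulgA hz) addrA.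
Qed.

Lemma gconv_diff2r v g : gconv v (one_sub_zV_sq R) g = diff2 v g.
Proof.
rewrite (gconv_lincombr _ _ one_sub_zV_sq_lincomb) !big_cons big_nil /= addr0.
rewrite invg1 mulg1 !mul1r (invgM hz^-1%g hz^-1%g) !invgK mulNr.
rewrite (mulgA g hz hz) -!(hz_central g).
by rewrite -(hz_central (hz * g)%g) addrA.
Qed.

Lemma fstar_sharp_diff2_l1 : exists K, l1_le (diff2 (fstar_sharp R)) K.
Proof.
have [] := @opb_diff2_summable heis R (translate R hx) (translate R hy)
  (translate R hz^-1%g).
- exact: opb_translate.
- exact: opb_translate.
- exact: opb_translate.
- by rewrite /GRing.comm -!translateM hzV_central.
- by rewrite /GRing.comm -!translateM hzV_central.
- by rewrite -!translateM hy_hx.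
set S := translate R hx + translate R hy.
set Z := 1 - translate R hz^-1%g.
have wordsE n : words n = (S ^+ n) (delta 1%g).
  elim: n => // n IHn; apply/funext => g.
  by rewrite wordsS exprS opME -IHn.
have ZE v g : (Z ^+ 2) v g = diff2 v g.
  rewrite expr2 opME /Z /diff2.
  rewrite -[LHS]/(v g - v (hz^-1^-1 * g)%g -
    (v (hz^-1^-1 * g)%g - v (hz^-1^-1 * (hz^-1^-1 * g))%g)) invgK; ring.
(* The factor [1/2] is [2^-(n+1) * 2^n]. Degrees in the finite [s] are bounded, so one partial sum
   represents [fstar_sharp] at all points involved; [hz] preserves the degree. *)
move=> c cP [K cK]; exists (2^-1 * K) => s us.
have [N sN] : exists N : nat, forall g, g \in s -> heis_deg g < N%:Z.
  elim: s {us} => [|g s [N sN]]; first by exists 0.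
  exists (maxn (absz (heis_deg g)).+1 N) => h; rewrite in_cons => /orP[/eqP ->|/sN]; lia.
have zd h : heis_deg (hz * h)%g = heis_deg h.
  by rewrite (heis_degM hz) heis_degz add0r.
have -> : \sum_(g <- s) `|diff2 (fstar_sharp R) g| =
    \sum_(g <- s) `|\sum_(n < N) 2 ^- n.+1 * diff2 (words n) g|.
  rewrite big_seq [RHS]big_seq; apply: eq_bigr => g /sN gN; congr `|_|.
  rewrite /diff2 !(@fstar_sharp_sum _ N) ?zd //.
  rewrite mulr_sumr -sumrB -big_split; apply: eq_bigr => n _ /=.
  by rewrite /sharp_term; ring.
apply: (@le_trans _ _ (\sum_(g <- s) \sum_(n < N) 2 ^- n.+1 * `|diff2 (words n) g|)).
  apply: ler_sum => g _; apply: le_trans (ler_norm_sum _ _ _) _.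
  by apply: ler_sum => n _; rewrite normrM ger0_norm // invr_ge0 exprn_ge0.
rewrite exchange_big /=; apply: (@le_trans _ _ (\sum_(n < N) 2^-1 * c n)).
  apply: ler_sum => n _; rewrite -mulr_sumr.
  have [_ /(_ _ _ (l1_le_delta R 1%g) s us)] := cP n.
  rewrite mulr1 opME -wordsE.
  under eq_bigr do rewrite ZE.
  move=> h; rewrite mulrC ler_pdivrMr ?exprn_gt0 //; apply: le_trans h _.
  by rewrite le_eqVlt; apply/orP; left; apply/eqP; rewrite exprS; field.
by rewrite -mulr_sumr ler_wpM2l.
Qed.

End FormalInverse.

(** * The q-binomial expansion *)

Section QBinomialTheorem.
Variable R : realType.
Implicit Types (p : {poly int}) (g : heis).

Lemma qbinom0 n : qbinom n 0 = 1.
Proof. by have := qbinomK n 0; rewrite !big_ord0 mulr1. Qed.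

Lemma qbinom_den_neq0 k : \prod_(i < k) (1 - 'X^(i.+1)) != 0 :> {poly int}.
Proof.
apply/prodf_neq0 => i _; rewrite subr_eq0 eq_sym.
by apply/eqP => /(congr1 (fun p : {poly int} => size p)); rewrite size_polyXn size_poly1.
Qed.

Lemma qbinom_small n : qbinom n n.+1 = 0.
Proof.
apply: (mulIf (qbinom_den_neq0 n.+1)); rewrite mul0r qbinomK.
by rewrite big_ord_recr /= subnn expr0 subrr mulr0.
Qed.

(** Cleared of denominators, this is [1 - X^(n+1) = (1 - X^(k+1)) + X^(k+1) (1 - X^(n-k))]. *)
Lemma qbinomS n k : (k <= n)%N ->
  qbinom n.+1 k.+1 = qbinom n k + 'X^(k.+1) * qbinom n k.+1.
Proof.
move=> kn; apply: (mulIf (qbinom_den_neq0 k.+1)).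
rewrite mulrDl -mulrA !qbinomK big_ord_recl subn0.
rewrite [in RHS]big_ord_recr /= mulrA qbinomK [in RHS]big_ord_recr /=.
under eq_bigr do rewrite /bump /= add1n subSS.
have -> : 'X^(n.+1) = 'X^(k.+1) * 'X^(n - k) :> {poly int}.
  by rewrite -exprD addSn subnKC.
ring.
Qed.

Definition poly_atz p : heis -> R := poly_at p (delta hz^-1%g).

Lemma cpow_deltaz j g :
  cpow (delta hz^-1%g : heis -> R) j g = (hz ^+ j * g == 1)%g%:R.
Proof.
elim: j g => [|j IHj] g; first by rewrite expg0 mul1g.
have dE d : (delta hz^-1%g : heis -> R) d =
    \sum_(p <- [:: (1, hz^-1%g)]) p.1 * (d == p.2)%:R.
  by rewrite big_seq1 mul1r.
by rewrite [LHS](gconv_lincombl _ _ dE) big_seq1 mul1r [LHS]IHj invgK mulgA -expgSr.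
Qed.

Lemma poly_atzE p M g : (size p <= M)%N ->
  poly_atz p g = \sum_(j < M) (p`_j)%:~R * (hz ^+ j * g == 1)%g%:R.
Proof.
move=> pM; rewrite /poly_atz /poly_at.
rewrite -(big_mkord xpredT (fun j => (p`_j)%:~R * cpow (delta hz^-1%g) j g)).
rewrite -(big_mkord xpredT (fun j => (p`_j)%:~R * (hz ^+ j * g == 1)%g%:R)).
rewrite (big_cat_nat (leq0n _) pM) /= [X in _ + X]big_nat [X in _ + X]big1 ?addr0.
  by apply: eq_bigr => j _; rewrite cpow_deltaz.
by move=> j /andP[pj _]; rewrite nth_default // mul0r.
Qed.

Lemma poly_atzD p q g : poly_atz (p + q) g = poly_atz p g + poly_atz q g.
Proof.
set M := maxn (size p) (size q).
rewrite !(@poly_atzE _ M) ?leq_maxl ?leq_maxr ?size_polyD // -big_split.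
by apply: eq_bigr => j _; rewrite coefD rmorphD mulrDl.
Qed.

Lemma poly_atz0 g : poly_atz 0 g = 0.
Proof. by rewrite (@poly_atzE _ 0) ?big_ord0 ?size_poly0. Qed.

Lemma poly_atzXn p k g : poly_atz ('X^k * p) g = poly_atz p (hz ^+ k * g)%g.
Proof.
rewrite (@poly_atzE p (size p)) // (@poly_atzE _ (k + size p)); last first.
  by apply: leq_trans (size_polyMleq _ _) _; rewrite size_polyXn.
rewrite big_split_ord /= big1 ?add0r => [|j _]; last first.
  by rewrite coefXnM ltn_ord mul0r.
apply: eq_bigr => j _; rewrite coefXnM ltnNge leq_addr /= addKn.
by rewrite addnC expgnDr mulgA.
Qed.

Lemma heis_xX k : (hx ^+ k)%g = heis_of k%:Z 0 0.
Proof.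
elim: k => [|k IHk]; first by rewrite heis_of1.
by rewrite expgS IHk heis_ofM; congr heis_of; lia.
Qed.

Lemma heis_yX k : (hy ^+ k)%g = heis_of 0 k%:Z 0.
Proof.
elim: k => [|k IHk]; first by rewrite heis_of1.
by rewrite expgS IHk heis_ofM; congr heis_of; lia.
Qed.

Lemma heis_zX k : (hz ^+ k)%g = heis_of 0 0 k%:Z.
Proof.
elim: k => [|k IHk]; first by rewrite heis_of1.
by rewrite expgS IHk hzE heis_ofM; congr heis_of; lia.
Qed.

Lemma words_qbinom n g : words R n g =
  \sum_(k < n.+1) poly_atz (qbinom n k) ((hx ^+ k * hy ^+ (n - k))^-1 * g)%g.
Proof.
elim: n g => [|n IHn] g.
  rewrite big_ord1 qbinom0 (@poly_atzE _ 1) ?size_poly1 // big_ord1 coef1 mul1r.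
  by rewrite !expg0 mulg1 invg1 !mul1g.
pose A k p := poly_atz p ((hx ^+ k * hy ^+ (n.+1 - k))^-1 * g)%g.
have xA (k : 'I_n.+1) : poly_atz (qbinom n k)
    ((hx ^+ k * hy ^+ (n - k))^-1 * (hx^-1 * g))%g = A k.+1 (qbinom n k).
  by rewrite /A subSS mulgA -invgM mulgA -expgS.
(* Moving [hy] past [hx ^+ k] yields the [k]-th power of [hz^-1], that is the factor ['X^k]. *)
have yA (k : 'I_n.+1) : poly_atz (qbinom n k)
    ((hx ^+ k * hy ^+ (n - k))^-1 * (hy^-1 * g))%g = A k ('X^k * qbinom n k).
  rewrite /A poly_atzXn !mulgA -invgM; congr (poly_atz _ (_ * _)%g).
  rewrite subSn; last by rewrite -ltnS.
  apply: invg_inj; rewrite invgK invgM invgK !heis_xX !heis_yX heis_zX.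
  by rewrite heis_ofV !heis_ofM; congr heis_of; lia.
rewrite wordsS !IHn (eq_bigr _ (fun k _ => xA k)) (eq_bigr _ (fun k _ => yA k)).
rewrite -[RHS]/(\sum_(k < n.+2) A k (qbinom n.+1 k)).
(* The added term [k = n.+1] vanishes, since the numerator of [qbinom n n.+1] contains
   [1 - 'X^0]. *)
have -> : \sum_(k < n.+1) A k ('X^k * qbinom n k) =
    \sum_(k < n.+2) A k ('X^k * qbinom n k).
  by rewrite [RHS]big_ord_recr /= qbinom_small mulr0 /A poly_atz0 addr0.
rewrite !(big_ord_recl n.+1) /= !qbinom0 mulr1 addrCA; congr (_ + _).
rewrite -big_split; apply: eq_bigr => k _ /=.
rewrite /bump /= add1n qbinomS; last by rewrite -ltnS.
by rewrite /A poly_atzD.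
Qed.

Lemma fstar_sharp_qbinomE : fstar_sharp R = fstar_sharp_qbinom R.
Proof.
apply/funext => g; congr (limn (series _)); apply/funext => n; congr (_ * _).
rewrite -[LHS]/(words R n g) words_qbinom; apply: eq_bigr => k _.
have dE d : (delta (hx ^+ k * hy ^+ (n - k))%g : heis -> R) d =
    \sum_(p <- [:: (1, (hx ^+ k * hy ^+ (n - k))%g)]) p.1 * (d == p.2)%:R.
  by rewrite big_seq1 mul1r.
by rewrite (gconv_lincombl _ _ dE) big_seq1 mul1r.
Qed.

End QBinomialTheorem.

(** * The homoclinic point *)

Section Homoclinic.
Variable R : realType.

Lemma circle_norm_mod1 (r : R) : 0 <= circle_norm (mod1 r) <= `|r|.
Proof.
have lb : lbound [set `|s| | s in [set s : R | mod1 s = mod1 r]] 0.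
  by move=> _ [s _ <-].
apply/andP; split; first by apply: lb_le_inf => //; exists `|r|; exists r.
by apply: ge_inf; [exists 0|exists r].
Qed.

Lemma rho_lincomb (G : groupType) (f : G -> int) (r : seq (int * G))
    (x : {ptws G -> circle R}) (h : G) :
  (forall d, f d = \sum_(p <- r) p.1 * (d == p.2)%:R) ->
  rho f x h = \sum_(p <- r) x (h * p.2)%g *~ p.1.
Proof.
move=> fE.
rewrite -[RHS](big_map (fun p : int * G => (p.2, x (h * p.2)%g *~ p.1)) xpredT snd).
rewrite -fsum_pick; apply: eq_fsbigr => d _; rewrite fE big_map mulrz_sumr.
by apply: eq_bigr => p _ /=; case: eqP => [->|_]; rewrite ?mulr1 ?mulr0.
Qed.

Lemma heis_f_lincomb d : heis_f d =
  \sum_(p <- [:: (2, 1%g); (-1, hx^-1%g); (-1, hy^-1%g)]) p.1 * (d == p.2)%:R.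
Proof.
rewrite !big_cons big_nil /= !mulN1r addr0 mulr_natl addrA.
by rewrite -[LHS]/(delta _ _ *+ 2 - delta _ _ - delta _ _) /delta.
Qed.

HB.instance Definition _ :=
  GRing.isZmodMorphism.Build R (circle R) (@mod1 R) (@mod1_additive R).

Local Notation w := (diff2 (fstar_sharp R)).

Lemma xbarE g : xbar R g = mod1 (w g).
Proof. by rewrite /xbar gconv_diff2r. Qed.

Lemma xbar_X : X_ heis_f (xbar R).
Proof.
apply/funext => h; rewrite (rho_lincomb _ _ heis_f_lincomb) !big_cons big_nil /=.
rewrite !xbarE -!raddfMz addr0 -!raddfD -(raddf0 (@mod1 R)); apply/mod1E.
rewrite subr0 mulg1 !mulrN1z addrA.
(* On real lifts, [rho heis_f] is right convolution by [f^*]. It commutes with [diff2] and turns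
   [fstar_sharp] into [delta 1], so the value is an integer. *)
have -> : w h *~ 2 - w (h * hx^-1)%g - w (h * hy^-1)%g =
    diff2 (fun g => 2 * fstar_sharp R g - fstar_sharp R (g * hx^-1)%g
      - fstar_sharp R (g * hy^-1)%g) h.
  rewrite /diff2 !(mulgA hz); ring.
rewrite /diff2 !fstar_sharp_mulr /delta.
by rewrite rpredD ?rpredB ?rpredM ?natr_int ?(natr_int 2).
Qed.

(** Markov's inequality: more than [k / e] such points would exceed the bound [k]. *)
Lemma l1_le_finite (G : choiceType) (v : G -> R) (k e : R) : 0 < e -> l1_le v k ->
  finite_set [set g | e <= `|v g|].
Proof.
move=> e0 vk; apply: contrapT => inf.
have [n kn] : exists n : nat, k < n%:R * e.
  exists (Num.bound (k / e)); rewrite -ltr_pdivrMr //; apply: archi_boundP.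
  by rewrite divr_ge0 ?(l1_le_ge0 vk) // ltW.
have [B BA nB] := infinite_set_fset n inf.
have := vk _ (finmap.fset_uniq B); apply/negP; rewrite -ltNge.
apply: (lt_le_trans kn).
apply: (@le_trans _ _ (\sum_(g <- finmap.enum_fset B) e)).
  by rewrite big_const_seq count_predT iter_addr_0 mulr_natl ler_pMn2l.
by rewrite big_seq [leRHS]big_seq; apply: ler_sum => g gB; exact: BA.
Qed.

Lemma xbar_cvg : (fun g => Defs.lshift g (xbar R)) @ @cofinite heis -->
  ((fun=> 0) : {ptws heis -> circle R}).
Proof.
(* The product topology is tested at one coordinate [h], where the shift by [g] reads off
   [g^-1 * h]; only finitely many of these points have [|w|] at least [e]. *)
apply/cvg_sup => h U [V] [[W] oW <-] W0 WU.
have [K wK] := fstar_sharp_diff2_l1 R.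
have /nbhs_ballP[e /= e0 eW] : nbhs (0 : R) (@mod1 R @^-1` W).
  apply: open_nbhs_nbhs; split; first exact: oW.
  by rewrite /= raddf0.
rewrite /cofinite /=.
apply: (@sub_finite_set _ _ ((fun g => h * g^-1)%g @` [set g | e <= `|w g|])).
  move=> g /= gU; exists (g^-1 * h)%g; last by rewrite invgM invgK mulgA mulgV mul1g.
  rewrite leNgt; apply/negP => we; apply: gU; apply: WU => /=.
  by rewrite /Defs.lshift xbarE; apply: eW; rewrite /ball /= sub0r normrN.
exact/finite_image/l1_le_finite/wK.
Qed.

Lemma xbar_summable : summable_point (xbar R).
Proof.
have [K wK] := fstar_sharp_diff2_l1 R.
apply: (@l1_le_summable _ _ _ K) => s us; apply: le_trans (wK s us).
apply: ler_sum => g _; rewrite xbarE; have /andP[c0 c1] := circle_norm_mod1 (w g).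
by rewrite ger0_norm.
Qed.

End Homoclinic.

Theorem theorem4p2 (R : realType) :
  [/\ [/\ bounded_fun (fstar_sharp R),
          formal_inverse (fstar_sharp R) (fstar R)
        & fstar_sharp R = fstar_sharp_qbinom R],
      summable [set: heis]
        (EFin \o gconv (one_sub_zV_sq R) (fstar_sharp R))
    & homoclinic heis_f (xbar R) /\ summable_point (xbar R)].
Proof.
split.
- split; [exact: fstar_sharp_bounded|exact: fstar_sharp_inverse|].
  exact: fstar_sharp_qbinomE.
- have [K wK] := fstar_sharp_diff2_l1 R; apply: (@l1_le_summable _ _ _ K) => s us.
  by under eq_bigr do rewrite gconv_diff2l; exact: wK.
- by split; [split; [exact: xbar_X|exact: xbar_cvg]|exact: xbar_summable].
Qed.
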